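(* Let $n_x,n_y,n_w$ be positive integers, let $f:[n_x]\times[n_y]\to\{0,1\}$, let $t(x,y)\ge 0$ with $\sum_{x,y}t(x,y)=1$, and for each $w\in[n_w]$ let $p(\cdot|w)$ be a probability distribution on $[n_x]$. Let $S^{(2)}_c$ be the optimal value of the figure of merit $S=\sum_{x,y}t(x,y)\,p(z=f(x,y)|x,y)$ over all classical oblivious communication strategies (defined in the context). For $y\in[n_y]$ and $z\in\{0,1\}$ put $F^z_y=\{x\in[n_x]: f(x,y)=z\}$. Then $$S^{(2)}_c\ \le\ \max_{\{q_x\}}\ \sum_{y=1}^{n_y}\max\left(\sum_{x\in F^0_y}t(x,y)\,q_x,\ \sum_{x\in F^1_y}t(x,y)\,q_x\right),$$ where the outer maximization is over all real tuples $(q_x)_{x\in[n_x]}$ satisfying $$q_x\ge 0\ \text{ for all } x\in[n_x],\qquad \sum_{x}p(x|w)\,q_x=1\ \text{ for all } w\in[n_w].$$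
   Context: Notation: $[n]=\{1,\dots,n\}$. One-way communication task: Alice receives $x\in[n_x]$ and sends a message to Bob; Bob receives $y\in[n_y]$ and outputs a bit $z\in\{0,1\}$, aiming at $z=f(x,y)$. Classical oblivious communication strategy: a message alphabet $\{1,\dots,N\}$ with $N$ an arbitrary positive integer (no bound on $N$), an encoding given by conditional probabilities $p_e(\tau|x)\ge 0$ with $\sum_{\tau}p_e(\tau|x)=1$ for every $x$, and a decoding given by conditional probabilities $p_d(z|y,\tau)\ge0$ with $p_d(0|y,\tau)+p_d(1|y,\tau)=1$ for all $y,\tau$, such that the encoding satisfies the oblivious constraint: for every $\tau$ and all $w,w'\in[n_w]$, $$\sum_x p(x|w)\,p_e(\tau|x)=\sum_x p(x|w')\,p_e(\tau|x).$$ The resulting observed probabilities are $p(z|x,y)=\sum_\tau p_e(\tau|x)\,p_d(z|y,\tau)$. The optimal value $S^{(2)}_c$ is the supremum of $S$ over all $N$ and all such strategies. The maximum on the right-hand side of the claimed inequality is read as a supremum in $[0,\infty]$ if it is not attained. *)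

(* Defs.v *)
From mathcomp Require Import all_boot all_order all_algebra.
From mathcomp Require Import boolp classical_sets reals ereal.

Set Implicit Arguments.
Unset Strict Implicit.
Unset Printing Implicit Defensive.

Import Order.TTheory GRing.Theory Num.Theory.
Local Open Scope ring_scope.

(* Bits are booleans (false is 0, true is 1).  A conditional distribution
   p(a|b) is written with the condition first, as in [p b a]. *)

Definition is_distribution (R : realType) (n : nat) (p : 'I_n -> R) : Prop :=
  (forall i, 0 <= p i) /\ \sum_(i < n) p i = 1.

Record oblivious_strategy (R : realType) (nx ny nw : nat)
    (p : 'I_nw -> 'I_nx -> R) := ObliviousStrategy {
  alphabet_size : nat;
  encoding : 'I_nx -> 'I_alphabet_size -> R;
  decoding : 'I_ny -> 'I_alphabet_size -> bool -> R;
  alphabet_size_gt0 : (0 < alphabet_size)%N;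
  encoding_distribution : forall x, is_distribution (encoding x);
  decoding_ge0 : forall y tau z, 0 <= decoding y tau z;
  decoding_sum1 :
    forall y tau, decoding y tau false + decoding y tau true = 1;
  encoding_oblivious : forall tau w w',
    \sum_(x < nx) p w x * encoding x tau =
    \sum_(x < nx) p w' x * encoding x tau
}.

Arguments encoding {R nx ny nw p} s x tau : rename.
Arguments decoding {R nx ny nw p} s y tau z : rename.

Definition observed (R : realType) (nx ny nw : nat) (p : 'I_nw -> 'I_nx -> R)
    (s : oblivious_strategy ny p) (x : 'I_nx) (y : 'I_ny) (z : bool) : R :=
  \sum_(tau < alphabet_size s) encoding s x tau * decoding s y tau z.

Definition figure_of_merit (R : realType) (nx ny nw : nat)
    (f : 'I_nx -> 'I_ny -> bool) (t : 'I_nx -> 'I_ny -> R)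
    (p : 'I_nw -> 'I_nx -> R) (s : oblivious_strategy ny p) : R :=
  \sum_(x < nx) \sum_(y < ny) t x y * observed s x y (f x y).

Definition optimal_oblivious_value (R : realType) (nx ny nw : nat)
    (f : 'I_nx -> 'I_ny -> bool) (t : 'I_nx -> 'I_ny -> R)
    (p : 'I_nw -> 'I_nx -> R) : \bar R :=
  ereal_sup (range (fun s : oblivious_strategy ny p =>
    (figure_of_merit f t s)%:E)).

Definition answer_set (nx ny : nat) (f : 'I_nx -> 'I_ny -> bool)
    (z : bool) (y : 'I_ny) : {set 'I_nx} :=
  [set x | f x y == z]%SET.

Definition admissible (R : realType) (nx nw : nat) (p : 'I_nw -> 'I_nx -> R)
    (q : 'I_nx -> R) : Prop :=
  (forall x, 0 <= q x) /\ (forall w, \sum_(x < nx) p w x * q x = 1).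

(* Main.v *)
(** Grouping the figure of merit by messages, message [tau] contributes at most
    the right-hand functional evaluated at the column [v = p_e(tau|.)]. That
    functional is monotone and positively homogeneous, and obliviousness says
    that [c = \sum_x p(x|w) v_x] does not depend on [w]. If [c > 0], then
    [v / c] is admissible. But [c] may vanish with [v <> 0] (inputs of
    probability zero under every [w]), so instead [v] is perturbed to
    [(v + e) / (c + e)], which is admissible for every [e > 0]; letting [e]
    tend to 0 bounds the contribution of [tau] by [c] times the supremum, and
    the [c]'s add up to 1. *)

Require Import Defs.
From mathcomp Require Import all_boot all_order all_algebra.
From mathcomp Require Import boolp classical_sets reals ereal.

Set Implicit Arguments.
Unset Strict Implicit.
Unset Printing Implicit Defensive.

Import Order.TTheory GRing.Theory Num.Theory.
Local Open Scope ring_scope.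

Section GuessingScore.
Variables (R : realType) (nx ny nw : nat).
Variables (f : 'I_nx -> 'I_ny -> bool) (t : 'I_nx -> 'I_ny -> R).
Hypothesis t_ge0 : forall x y, 0 <= t x y.

Definition guessing_score (q : 'I_nx -> R) : R :=
  \sum_(y < ny) Num.max (\sum_(x in answer_set f false y) t x y * q x)
                        (\sum_(x in answer_set f true y) t x y * q x).

Lemma guessing_score_mono (q r : 'I_nx -> R) :
  (forall x, q x <= r x) -> guessing_score q <= guessing_score r.
Proof.
move=> le_qr; apply: ler_sum => y _.
by apply: le_max2; apply: ler_sum => x _; apply: ler_wpM2l.
Qed.

Lemma guessing_scoreZ (a : R) (q : 'I_nx -> R) : 0 <= a ->
  guessing_score (fun x => a * q x) = a * guessing_score q.
Proof.
move=> a_ge0; rewrite /guessing_score mulr_sumr; apply: eq_bigr => y _.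
rewrite maxr_pMr // !mulr_sumr.
by congr Num.max; apply: eq_bigr => x _; rewrite mulrCA.
Qed.

Lemma guessing_score_ge0 (q : 'I_nx -> R) :
  (forall x, 0 <= q x) -> 0 <= guessing_score q.
Proof.
move=> q_ge0; apply: sumr_ge0 => y _; rewrite le_max.
by rewrite sumr_ge0 // => x _; rewrite mulr_ge0.
Qed.

Lemma convex_comb_le_max (a b u v : R) : 0 <= a -> 0 <= b -> a + b = 1 ->
  a * u + b * v <= Num.max u v.
Proof.
move=> a_ge0 b_ge0 ab1; rewrite -[leRHS]mul1r -ab1 mulrDl.
by apply: lerD; apply: ler_wpM2l; rewrite // le_max lexx ?orbT.
Qed.

(** For fixed [y], the sum over [x] is the convex combination, with weights [d y false] and
    [d y true], of the two arguments of the maximum. *)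
Lemma decoding_le_guessing_score (v : 'I_nx -> R) (d : 'I_ny -> bool -> R) :
  (forall y z, 0 <= d y z) -> (forall y, d y false + d y true = 1) ->
  \sum_(x < nx) \sum_(y < ny) t x y * (v x * d y (f x y)) <= guessing_score v.
Proof.
move=> d_ge0 d_sum1; rewrite exchange_big; apply: ler_sum => y _.
apply: le_trans (convex_comb_le_max _ _ (d_ge0 y false) (d_ge0 y true) _) => //.
(* Split by the answer [f x y], the [false] half first; both halves then match as equalities. *)
rewrite (bigID (fun x => f x y)) /= addrC !mulr_sumr.
apply: lerD; rewrite le_eqVlt; apply/orP; left; apply/eqP.
  apply: eq_big => [x|x /negbTE ->]; first by rewrite inE; case: (f x y).
  by rewrite mulrA mulrC.
apply: eq_big => [x|x ->]; first by rewrite inE; case: (f x y).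
by rewrite mulrA mulrC.
Qed.

Variable p : 'I_nw -> 'I_nx -> R.
Hypothesis p_distribution : forall w, is_distribution (p w).

(** Witness that admissible tuples exist: it forces upper bounds [M] to be nonnegative and keeps the
    supremum above minus infinity. *)
Lemma admissible1 : admissible p (fun=> 1).
Proof.
split=> // w; case: (p_distribution w) => _ {2}<-.
by apply: eq_bigr => x _; rewrite mulr1.
Qed.

Lemma guessing_score_le (M c : R) (v : 'I_nx -> R) :
  (forall q, admissible p q -> guessing_score q <= M) ->
  (forall x, 0 <= v x) -> 0 <= c -> (forall w, \sum_(x < nx) p w x * v x = c) ->
  guessing_score v <= c * M.
Proof.
move=> leM v_ge0 c_ge0 vc.
have M_ge0 : 0 <= M.
  by apply: le_trans (leM _ admissible1); apply: guessing_score_ge0.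
apply/ler_addgt0Pr => d d_gt0.
have M1_gt0 : 0 < M + 1 by rewrite ltr_wpDl.
(* Chosen so that [e * M <= d]; the [+ 1] covers [M = 0]. *)
pose e := d / (M + 1).
have e_gt0 : 0 < e by rewrite divr_gt0.
have ce_gt0 : 0 < c + e by rewrite ltr_wpDl.
have adm : admissible p (fun x => (c + e)^-1 * (v x + e)).
  split=> [x|w]; first by rewrite mulr_ge0 ?invr_ge0 ?addr_ge0 // ltW.
  under eq_bigr => x _ do rewrite mulrCA mulrDr.
  rewrite -mulr_sumr big_split /= vc -mulr_suml.
  by case: (p_distribution w) => _ ->; rewrite mul1r mulVf // gt_eqF.
apply: le_trans (_ : guessing_score (fun x => v x + e) <= _).
  by apply: guessing_score_mono => x; rewrite lerDl ltW.
have := leM _ adm; rewrite guessing_scoreZ ?invr_ge0 ?(ltW ce_gt0) //.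
rewrite ler_pdivrMl // => /le_trans; apply.
by rewrite mulrDl lerD2l /e mulrAC ler_pdivrMr // ler_pM2l // lerDl.
Qed.

(** The index [w0] only serves to name the weight [c tau] of a message, which obliviousness makes
    the same for every [w]. *)
Lemma figure_of_merit_le (M : R) (s : oblivious_strategy ny p) (w0 : 'I_nw) :
  (forall q, admissible p q -> guessing_score q <= M) ->
  figure_of_merit f t s <= M.
Proof.
move=> leM; have e_ge0 x tau : 0 <= encoding s x tau.
  by case: (encoding_distribution s x).
pose c tau := \sum_(x < nx) p w0 x * encoding s x tau.
have c_sum1 : \sum_tau c tau = 1.
  rewrite exchange_big /=; case: (p_distribution w0) => _ <-.
  apply: eq_bigr => x _; rewrite -mulr_sumr.
  by case: (encoding_distribution s x) => _ ->; rewrite mulr1.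
rewrite -[M]mul1r -c_sum1 mulr_suml.
(* Moving the sum over messages outermost lets each [tau] be bounded separately by [c tau * M]. *)
have -> : figure_of_merit f t s =
    \sum_tau \sum_(x < nx) \sum_(y < ny)
      t x y * (encoding s x tau * decoding s y tau (f x y)).
  rewrite exchange_big; apply: eq_bigr => x _.
  by rewrite exchange_big; apply: eq_bigr => y _; rewrite mulr_sumr.
apply: ler_sum => tau _.
apply: le_trans (_ : guessing_score (encoding s ^~ tau) <= _).
  apply: (@decoding_le_guessing_score _ (fun y => decoding s y tau)) => *.
    exact: decoding_ge0.
  exact: decoding_sum1.
apply: guessing_score_le => // [|w]; last exact: encoding_oblivious.
apply: sumr_ge0 => x _; rewrite mulr_ge0 //.
by case: (p_distribution w0).
Qed.

End GuessingScore.

Theorem proposition1 (R : realType) (nx ny nw : nat)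
    (nx_gt0 : (0 < nx)%N) (ny_gt0 : (0 < ny)%N) (nw_gt0 : (0 < nw)%N)
    (f : 'I_nx -> 'I_ny -> bool) (t : 'I_nx -> 'I_ny -> R)
    (p : 'I_nw -> 'I_nx -> R)
    (t_ge0 : forall x y, 0 <= t x y)
    (t_sum1 : \sum_(x < nx) \sum_(y < ny) t x y = 1)
    (p_distribution : forall w, is_distribution (p w)) :
  (optimal_oblivious_value f t p <=
   ereal_sup
     [set (\sum_(y < ny)
             Num.max (\sum_(x in answer_set f false y) t x y * q x)
                     (\sum_(x in answer_set f true y) t x y * q x))%:E
     | q in [set q : 'I_nx -> R | admissible p q]])%E.
Proof.
apply: ge_ereal_sup => _ [s _ <-].
set S := ereal_sup _.
have leS q : admissible p q -> ((guessing_score f t q)%:E <= S)%E.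
  by move=> adm; apply: ereal_sup_ubound; exists q.
(* Only a finite supremum needs the real-valued bound: plus infinity is trivial, minus infinity is
   excluded by the constant tuple 1. *)
case: S leS => [M||] leS; last 2 first.
- exact: leey.
- by have := leS _ (admissible1 p_distribution); rewrite leeNy_eq.
rewrite lee_fin.
apply: (figure_of_merit_le t_ge0 p_distribution s (Ordinal nw_gt0)) => q adm.
by rewrite -lee_fin; apply: leS.
Qed.
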